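(* $$\frac{5\pi}{4\sqrt{3}} = \sum_{k=0}^{\infty}\left(\frac14\right)^{k}\frac{\left(\frac13\right)_k (1)_k\left(\frac53\right)_k}{\left(\frac76\right)_k\left(\frac32\right)_k\left(\frac{11}{6}\right)_k}\,(3k+2).$$
   Context: For $k\in\mathbb{N}_0$, $(\alpha)_k=\alpha(\alpha+1)\cdots(\alpha+k-1)$ is the rising factorial (Pochhammer symbol), with $(\alpha)_0=1$. *)

(* Defs.v *)
From Stdlib Require Import Reals.
Open Scope R_scope.

(* Rising factorial a (a + 1) ... (a + k - 1); the empty product is 1. *)
Fixpoint poch (a : R) (k : nat) : R :=
  match k with
  | O => 1
  | S j => poch a j * (a + INR j)
  end.

(* Main.v *)
Require Import Defs.
From Stdlib Require Import Reals Lra Lia.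
From Coquelicot Require Import Coquelicot.
Open Scope R_scope.

(** The triplication formula turns the [k]-th term into an explicit multiple of
    (3k)! / (3/2)_{3k}, which is the integral of (1 - y^2)^{3k} over [0,1].
    Since 4 - 2 (n+1)/(n+3/2) + (n+1)(n+2)/((n+3/2)(n+5/2)) is a multiple of
    (n+2)^2, the term is exactly the integral of 5/2 (3 + y^4) z^k / 4 with
    z = (1 - y^2)^3 / 4.  Summing the geometric series leaves the integral of
    5/2 (3 + y^4) / D with D = 4 - (1 - y^2)^3.  For A = 3 y - y^3 and
    B = sqrt 3 (1 - y^2) one has D = A^2 + B^2 and A' B - A B' = sqrt 3 (3 + y^4),
    so the integrand is a multiple of the derivative of the argument of B + i A,
    which runs from 0 to PI / 2. *)

Lemma poch_pos (a : R) (k : nat) : 0 < a -> 0 < poch a k.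
Proof.
intros Ha; induction k as [|k IH]; simpl; [lra|].
apply Rmult_lt_0_compat; [exact IH|].
generalize (pos_INR k); lra.
Qed.

(** Both sides are the product a (a + 1) ... (a + k). *)
Lemma poch_shift (a : R) (k : nat) : a * poch (a + 1) k = poch a k * (a + INR k).
Proof.
induction k as [|k IH]; [simpl; ring|].
cbn [poch]; rewrite <- Rmult_assoc, IH, S_INR; ring.
Qed.

Lemma poch_triple (a : R) (k : nat) :
  poch a (3 * k) =
  27 ^ k * (poch (a / 3) k * poch ((a + 1) / 3) k * poch ((a + 2) / 3) k).
Proof.
induction k as [|k IH]; [simpl; ring|].
replace (3 * S k)%nat with (S (S (S (3 * k)))) by lia.
cbn [poch]; rewrite IH, !S_INR, mult_INR.
simpl (INR 3); simpl pow; field.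
Qed.

(** The function y (1 - y^2)^(n+1) vanishes at 0 and 1. Integrating its derivative gives (2n + 3)
    I_(n+1) = (2n + 2) I_n, where I_n is the integral for exponent n. *)
Lemma is_RInt_pow_one_minus_sqr (n : nat) :
  is_RInt (fun y => (1 - y ^ 2) ^ n) 0 1 (poch 1 n / poch (3 / 2) n).
Proof.
induction n as [|n IH].
- simpl; replace (1 / 1) with (scal (1 - 0) 1)
    by (unfold scal; simpl; unfold mult; simpl; lra).
  apply (is_RInt_const (V := R_NormedModule) 0 1 1).
- assert (Hn := pos_INR n).
  assert (HD : is_RInt
     (fun y => (2 * INR n + 3) * (1 - y ^ 2) ^ S n - (2 * INR n + 2) * (1 - y ^ 2) ^ n)
     0 1 (minus (1 * (1 - 1 ^ 2) ^ S n) (0 * (1 - 0 ^ 2) ^ S n))).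
  { apply (is_RInt_derive (fun y => y * (1 - y ^ 2) ^ S n)).
    - intros y _; auto_derive; [exact I|].
      change (match n with O => 1 | S _ => INR n + 1 end) with (INR (S n)).
      rewrite S_INR.
      simpl pow; unfold Rminus; ring.
    - intros y _; apply (ex_derive_continuous (V := R_NormedModule)).
      auto_derive; exact I. }
  apply (is_RInt_scal _ _ _ (2 * INR n + 2)) in IH.
  generalize (is_RInt_scal _ _ _ (/ (2 * INR n + 3)) _ (is_RInt_plus _ _ _ _ _ _ HD IH)).
  replace (poch 1 (S n) / poch (3 / 2) (S n)) with
    (scal (/ (2 * INR n + 3))
       (plus (minus (1 * (1 - 1 ^ 2) ^ S n) (0 * (1 - 0 ^ 2) ^ S n))
          (scal (2 * INR n + 2) (poch 1 n / poch (3 / 2) n)))).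
  + apply is_RInt_ext; intros y _.
    unfold scal, plus; simpl; unfold mult; simpl; field; lra.
  + assert (Hp := poch_pos (3 / 2) n ltac:(lra)).
    unfold scal, plus, minus, opp; simpl; unfold plus, opp, mult; simpl.
    field; split; lra.
Qed.

Definition series_term (k : nat) : R :=
  (1 / 4) ^ k *
  ((poch (1 / 3) k * poch 1 k * poch (5 / 3) k) /
   (poch (7 / 6) k * poch (3 / 2) k * poch (11 / 6) k)) *
  (3 * INR k + 2).

(** Triplication at 1 and 3/2 produces the parameters 1/3, 2/3, 1 and 1/2, 5/6, 7/6. Lowering 5/3,
    3/2 and 11/6 by one with [poch_shift] yields the rational factor. *)
Lemma series_term_beta (k : nat) :
  series_term k =
  5 / 2 * (1 / 4) ^ k *
  (poch 1 (3 * k) / poch (3 / 2) (3 * k)) *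
  (3 * (3 * INR k + 2) ^ 2 / ((6 * INR k + 3) * (6 * INR k + 5))).
Proof.
unfold series_term; rewrite !poch_triple.
assert (Hk := pos_INR k).
assert (H1 := poch_shift (2 / 3) k).
assert (H2 := poch_shift (1 / 2) k).
assert (H3 := poch_shift (5 / 6) k).
replace (2 / 3 + 1) with (5 / 3) in H1 by field.
replace (1 / 2 + 1) with (3 / 2) in H2 by field.
replace (5 / 6 + 1) with (11 / 6) in H3 by field.
replace ((1 + 1) / 3) with (2 / 3) by field.
replace ((1 + 2) / 3) with 1 by field.
replace (3 / 2 / 3) with (1 / 2) by field.
replace ((3 / 2 + 1) / 3) with (5 / 6) by field.
replace ((3 / 2 + 2) / 3) with (7 / 6) by field.
assert (P1 := poch_pos (1 / 2) k ltac:(lra)).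
assert (P2 := poch_pos (5 / 6) k ltac:(lra)).
assert (P3 := poch_pos (7 / 6) k ltac:(lra)).
assert (P4 : 0 < 27 ^ k) by (apply pow_lt; lra).
replace (poch (5 / 3) k) with (poch (2 / 3) k * (2 / 3 + INR k) * (3 / 2)) by lra.
replace (poch (3 / 2) k) with (poch (1 / 2) k * (1 / 2 + INR k) * 2) by lra.
replace (poch (11 / 6) k) with (poch (5 / 6) k * (5 / 6 + INR k) * (6 / 5)) by lra.
field; repeat split; lra.
Qed.

Lemma is_RInt_series_term (k : nat) :
  is_RInt (fun y => 5 / 8 * (3 + y ^ 4) * ((1 - y ^ 2) ^ 3 / 4) ^ k) 0 1
    (series_term k).
Proof.
set (n := (3 * k)%nat).
assert (I0 := is_RInt_pow_one_minus_sqr n).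
assert (I1 := is_RInt_pow_one_minus_sqr (S n)).
assert (I2 := is_RInt_pow_one_minus_sqr (S (S n))).
(* with u = 1 - y^2, 3 + y^4 = 4 - 2 u + u^2 *)
generalize (is_RInt_scal _ _ _ (5 / 8 * (1 / 4) ^ k) _
  (is_RInt_plus _ _ _ _ _ _
    (is_RInt_plus _ _ _ _ _ _ (is_RInt_scal _ _ _ 4 _ I0) (is_RInt_scal _ _ _ (-2) _ I1))
    I2)).
match goal with |- is_RInt _ _ _ ?v -> _ => replace v with (series_term k) end.
- apply is_RInt_ext; intros y _.
  unfold scal, plus; cbn -[pow n]; unfold mult; cbn -[pow n].
  replace (((1 - y ^ 2) ^ 3 / 4) ^ k) with ((1 / 4) ^ k * (1 - y ^ 2) ^ n)
    by (unfold n; rewrite pow_mult, <- Rpow_mult_distr; f_equal; field).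
  cbn [pow]; ring.
- rewrite series_term_beta; fold n.
  unfold scal, plus; cbn -[pow INR n]; unfold mult; cbn -[pow INR n].
  assert (Hn : INR n = 3 * INR k) by (unfold n; rewrite mult_INR; simpl; ring).
  assert (Hk := pos_INR k).
  assert (P := poch_pos (3 / 2) n ltac:(lra)).
  rewrite S_INR, Hn.
  (* The three integrals combine to I_n times 12 (n + 2)^2 / ((2n + 3) (2n + 5)), with n = 3k. *)
  field; repeat split; lra.
Qed.

(** With t = y^2, 1 - (1 - t)^3 = t (t^2 - 3t + 3), and the quadratic is positive. *)
Lemma denominator_ge_3 (y : R) : 3 <= 4 - (1 - y ^ 2) ^ 3.
Proof.
assert (H := pow2_ge_0 y).
replace (4 - (1 - y ^ 2) ^ 3) with
  (3 + y ^ 2 * ((y ^ 2 - 3 / 2) ^ 2 + 3 / 4)) by field.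
assert (H' := pow2_ge_0 (y ^ 2 - 3 / 2)).
nra.
Qed.

Lemma is_RInt_limit_density :
  is_RInt (fun y => 5 / 2 * (3 + y ^ 4) / (4 - (1 - y ^ 2) ^ 3)) 0 1
    (5 * PI / (4 * sqrt 3)).
Proof.
assert (Hs : 0 < sqrt 3) by (apply sqrt_lt_R0; lra).
assert (Hs2 : sqrt 3 * sqrt 3 = 3) by (apply sqrt_sqrt; lra).
set (s := sqrt 3) in *.
(* The argument of B + i A shifted by PI / 4, so that no pole occurs at y = 1. *)
set (F := fun y => 5 / (2 * s) *
   atan ((3 * y - y ^ 3 - s * (1 - y ^ 2)) / (3 * y - y ^ 3 + s * (1 - y ^ 2)))).
replace (5 * PI / (4 * s)) with (minus (F 1) (F 0)).
- apply (is_RInt_derive F).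
  + rewrite Rmin_left, Rmax_right by lra; intros y Hy.
    (* A + B > 0 on [0,1]: A > 0 and B >= 0 for y > 0, while at y = 0 the sum is [s]. *)
    assert (HAB : 0 < 3 * y - y ^ 3 + s * (1 - y ^ 2)).
    { destruct (Rlt_or_le 0 y) as [Hy0|Hy0].
      - assert (0 <= 1 - y ^ 2) by nra.
        assert (0 <= s * (1 - y ^ 2)) by (apply Rmult_le_pos; lra).
        replace (3 * y - y ^ 3) with (y * (2 + (1 - y ^ 2))) by ring.
        nra.
      - replace y with 0 by lra; simpl; lra. }
    assert (HD := denominator_ge_3 y).
    assert (E1 : (3 * y - y ^ 3 + s * (1 - y ^ 2)) ^ 2
                 + (3 * y - y ^ 3 - s * (1 - y ^ 2)) ^ 2
                 = 2 * (4 - (1 - y ^ 2) ^ 3)).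
    { transitivity (2 * (3 * y - y ^ 3) ^ 2 + 2 * (s * s) * (1 - y ^ 2) ^ 2); [ring|].
      rewrite Hs2; ring. }
    unfold F; auto_derive; [lra|].
    set (P := 3 * y - y ^ 3 + s * (1 - y ^ 2)) in *.
    set (M := 3 * y - y ^ 3 - s * (1 - y ^ 2)) in *.
    set (D := 4 - (1 - y ^ 2) ^ 3) in *.
    (* This is (M' P - P' M) / (P^2 + M^2), from the derivative of atan (M / P). Since P = A + B and
       M = A - B, the numerator is 2 (A' B - A B'). *)
    match goal with |- ?l = _ => transitivity
      (5 / (2 * s) * (((3 - 3 * y ^ 2 + 2 * s * y) * P
                      - (3 - 3 * y ^ 2 - 2 * s * y) * M) / (P ^ 2 + M ^ 2))) end.
    * unfold P, M in *; field; repeat split; try lra; nra.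
    * rewrite E1.
      replace ((3 - 3 * y ^ 2 + 2 * s * y) * P - (3 - 3 * y ^ 2 - 2 * s * y) * M)
        with (2 * s * (3 + y ^ 4)) by (unfold P, M; ring).
      field; split; lra.
  + intros y _; apply (ex_derive_continuous (V := R_NormedModule)).
    assert (HD := denominator_ge_3 y).
    auto_derive; lra.
- unfold F, minus, plus, opp; simpl.
  (* B = 0 at y = 1 and A = 0 at y = 0, so the quotient runs from -1 to 1. *)
  replace ((3 * 1 - 1 * (1 * (1 * 1)) - s * (1 - 1 * (1 * 1))) /
           (3 * 1 - 1 * (1 * (1 * 1)) + s * (1 - 1 * (1 * 1)))) with 1 by (field; lra).
  replace ((3 * 0 - 0 * (0 * (0 * 1)) - s * (1 - 0 * (0 * 1))) /
           (3 * 0 - 0 * (0 * (0 * 1)) + s * (1 - 0 * (0 * 1)))) with (-1)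
    by (field; lra).
  replace (-1) with (- (1)) by ring.
  rewrite atan_opp, atan_1; field; lra.
Qed.

(** A finite geometric sum in z, using D = 4 (1 - z). The exponent is [S N] because [sum_n] includes
    the index [N]. *)
Lemma is_RInt_partial_sum (N : nat) :
  is_RInt (fun y => 5 / 2 * (3 + y ^ 4) / (4 - (1 - y ^ 2) ^ 3) *
                    (1 - ((1 - y ^ 2) ^ 3 / 4) ^ S N)) 0 1
    (sum_n series_term N).
Proof.
induction N as [|N IH].
- rewrite sum_O; generalize (is_RInt_series_term 0).
  apply is_RInt_ext; intros y _.
  assert (HD := denominator_ge_3 y).
  simpl in *; field; lra.
- rewrite sum_Sn.
  generalize (is_RInt_plus _ _ _ _ _ _ IH (is_RInt_series_term (S N))).
  apply is_RInt_ext; intros y _.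
  assert (HD := denominator_ge_3 y).
  unfold plus; simpl in *; field; lra.
Qed.

(** The error is the integral of the limit density times z^(N+1), where 0 <= z <= 1/4. *)
Lemma partial_sum_error (N : nat) :
  0 <= 5 * PI / (4 * sqrt 3) - sum_n series_term N <= 4 * (1 / 4) ^ N.
Proof.
assert (HI := is_RInt_minus _ _ _ _ _ _ is_RInt_limit_density (is_RInt_partial_sum N)).
assert (Hz : forall y, 0 < y < 1 -> 0 <= (1 - y ^ 2) ^ 3 / 4 <= 1 / 4).
{ intros y Hy.
  assert (Hu : 0 <= 1 - y ^ 2 <= 1) by nra.
  assert (0 <= (1 - y ^ 2) ^ 3) by (apply pow_le; lra).
  assert ((1 - y ^ 2) ^ 3 <= 1 ^ 3) by (apply pow_incr; lra).
  lra. }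
assert (HE : forall y, 0 < y < 1 ->
  0 <= minus (5 / 2 * (3 + y ^ 4) / (4 - (1 - y ^ 2) ^ 3))
     (5 / 2 * (3 + y ^ 4) / (4 - (1 - y ^ 2) ^ 3) * (1 - ((1 - y ^ 2) ^ 3 / 4) ^ S N))
  <= 4 * (1 / 4) ^ N).
{ intros y Hy.
  assert (HD := denominator_ge_3 y).
  assert (Hzy := Hz y Hy).
  assert (H0 : 0 <= ((1 - y ^ 2) ^ 3 / 4) ^ S N) by (apply pow_le; lra).
  assert (H1 : ((1 - y ^ 2) ^ 3 / 4) ^ S N <= (1 / 4) ^ S N) by (apply pow_incr; lra).
  (* The crude bound 16 makes 16 (1/4)^(N+1) equal to 4 (1/4)^N. *)
  assert (Hg : 0 <= 5 / 2 * (3 + y ^ 4) / (4 - (1 - y ^ 2) ^ 3) <= 16).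
  { assert (0 <= y ^ 4) by (apply pow_le; lra).
    assert (y ^ 4 <= 1 ^ 4) by (apply pow_incr; lra).
    split.
    - apply Rdiv_le_0_compat; lra.
    - apply Rle_div_l; lra. }
  set (g := 5 / 2 * (3 + y ^ 4) / (4 - (1 - y ^ 2) ^ 3)) in *.
  set (w := ((1 - y ^ 2) ^ 3 / 4) ^ S N) in *.
  replace (minus _ _) with (g * w) by (unfold minus, plus, opp; simpl; ring).
  simpl in H1.
  split; [apply Rmult_le_pos; lra|].
  replace (4 * (1 / 4) ^ N) with (16 * (1 / 4 * (1 / 4) ^ N)) by field.
  apply Rmult_le_compat; lra. }
split.
- assert (H := is_RInt_le _ _ 0 1 _ _ ltac:(lra)
    (is_RInt_const (V := R_NormedModule) 0 1 0) HI (fun y Hy => proj1 (HE y Hy))).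
  unfold scal, minus, plus, opp in H; simpl in H; unfold mult in H; simpl in H; lra.
- assert (H := is_RInt_le _ _ 0 1 _ _ ltac:(lra) HI
    (is_RInt_const (V := R_NormedModule) 0 1 (4 * (1 / 4) ^ N))
    (fun y Hy => proj2 (HE y Hy))).
  unfold scal, minus, plus, opp in H; simpl in H; unfold mult in H; simpl in H; lra.
Qed.

Theorem mainTheorem4 :
  is_series
    (fun k : nat =>
       (1 / 4) ^ k *
       ((poch (1 / 3) k * poch 1 k * poch (5 / 3) k) /
        (poch (7 / 6) k * poch (3 / 2) k * poch (11 / 6) k)) *
       (3 * INR k + 2))
    (5 * PI / (4 * sqrt 3)).
Proof.
change (is_lim_seq (sum_n series_term) (5 * PI / (4 * sqrt 3))).
set (L := 5 * PI / (4 * sqrt 3)).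
(* Squeeze the partial sums by the error bound. *)
apply is_lim_seq_le_le with (u := fun N => L - 4 * (1 / 4) ^ N) (w := fun _ => L).
- intros N; assert (H := partial_sum_error N); fold L in H; lra.
- evar_last; [apply is_lim_seq_minus'; [apply is_lim_seq_const|]|].
  2: instantiate (1 := 4 * 0); apply f_equal; ring.
  apply (is_lim_seq_scal_l _ 4 0), is_lim_seq_geom.
  rewrite Rabs_pos_eq; lra.
- apply is_lim_seq_const.
Qed.
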